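(* Let $L$ be an effect algebra. If $L$ has the Grothendieck property and the Nikodým property, then $L$ has the Vitali-Hahn-Saks property. Likewise, if $L$ has the $\sigma$-Grothendieck property and the $\sigma$-Nikodým property, then $L$ has the $\sigma$-Vitali-Hahn-Saks property.
   Context: An effect algebra $(L,\oplus,0,1)$ is a set $L$ with elements $0,1\in L$ and a partial binary operation $\oplus$ such that for all $p,q,r\in L$: (E1) if $p\oplus q$ is defined then $q\oplus p$ is defined and equal to it; (E2) if $q\oplus r$ and $p\oplus(q\oplus r)$ are defined then $p\oplus q$ and $(p\oplus q)\oplus r$ are defined and $(p\oplus q)\oplus r=p\oplus(q\oplus r)$; (E3) for every $p$ there is a unique $q$ with $p\oplus q=1$; (E4) if $1\oplus p$ is defined then $p=0$. The partial order on $L$ is: $p\le q$ iff there is $r$ with $p\oplus r=q$. Elements $p,q$ are orthogonal if $p\oplus q$ is defined. Finite orthosums are defined inductively (independent of the order). A sequence $(a_n)_{n\in\mathbb{N}}$ in $L$ is orthogonal if for every finite set $F$ of indices $\bigoplus_{n\in F}a_n$ exists; $\bigoplus_{n\in\mathbb{N}}a_n$ denotes the supremum of $\{\bigoplus_{n\in F}a_n: F\subset\mathbb{N}\text{ finite}\}$ in $L$, if it exists. A (real-valued) measure is a map $\mu:L\to\mathbb{R}$ with $\mu(a\oplus b)=\mu(a)+\mu(b)$ for orthogonal $a,b$; it is bounded if $\sup_{a\in L}|\mu(a)|<\infty$; it is $\sigma$-additive if $\mu(\bigoplus_{n}a_n)=\sum_{n}\mu(a_n)$ for every orthogonal sequence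 $(a_n)$ such that $\bigoplus_n a_n$ exists. A sequence $(\mu_i)_{i\in\mathbb{N}}$ of measures is: pointwise bounded if for each $a\in L$, $\sup_i|\mu_i(a)|<\infty$; uniformly bounded if $\sup_{i}\sup_{a\in L}|\mu_i(a)|<\infty$; pointwise convergent if $\lim_i\mu_i(a)$ exists (in $\mathbb{R}$) for every $a\in L$; uniformly exhaustive if for every orthogonal sequence $(a_n)$, $\lim_n\mu_i(a_n)=0$ uniformly in $i$; uniformly strongly additive if for every orthogonal sequence $(a_n)$, the partial sums $\sum_{k=1}^n\mu_i(a_k)$ converge as $n\to\infty$ uniformly in $i$. $L$ has: the Nikodým property if every pointwise bounded sequence of bounded real-valued measures on $L$ is uniformly bounded; the Vitali-Hahn-Saks property if every pointwise convergent sequence of bounded real-valued measures on $L$ is uniformly exhaustive; the Grothendieck property if every pointwise convergent and uniformly bounded sequence of bounded real-valued measures on $L$ is uniformly strongly additive. The $\sigma$-Nikodým, $\sigma$-Vitali-Hahn-Saks and $\sigma$-Grothendieck properties are the same conditions required only for sequences of bounded $\sigma$-additive real-valued measures. *)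

(* Defs.v *)
From HB Require Import structures.
From mathcomp Require Import all_boot all_order all_algebra finmap.
From mathcomp Require Import all_classical all_reals all_analysis.

Set Implicit Arguments.
Unset Strict Implicit.
Unset Printing Implicit Defensive.

Import Order.TTheory GRing.Theory Num.Theory.
Import numFieldNormedType.Exports.

Local Open Scope classical_set_scope.
Local Open Scope ring_scope.

(* [eadd p q = Some r] means that p (+) q is defined and equal to r;
   [eadd p q = None] means that it is undefined. *)
Record effectAlgebra := EffectAlgebra {
  ea_sort :> Type;
  eadd : ea_sort -> ea_sort -> option ea_sort;
  ezero : ea_sort;
  eone : ea_sort;
  eaddC : forall p q r, eadd p q = Some r -> eadd q p = Some r;
  eaddA : forall p q r qr pqr, eadd q r = Some qr -> eadd p qr = Some pqr ->
    exists pq, eadd p q = Some pq /\ eadd pq r = Some pqr;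
  eorthosuppl : forall p, exists! q, eadd p q = Some eone;
  eone_max : forall p r, eadd eone p = Some r -> p = ezero
}.

Arguments ezero {e}.
Arguments eone {e}.

Definition ele (L : effectAlgebra) (p q : L) : Prop :=
  exists r, eadd p r = Some q.

Definition eis_sup (L : effectAlgebra) (A : set L) (s : L) : Prop :=
  (forall x, A x -> ele x s) /\
  (forall u, (forall x, A x -> ele x u) -> ele s u).

(* (..((0 (+) x_1) (+) x_2)..) (+) x_n, undefined as soon as one step is *)
Definition orthosum_seq (L : effectAlgebra) (s : seq L) : option L :=
  foldl (fun acc x => obind (fun y => eadd y x) acc) (Some ezero) s.

(* F is listed in its canonical enumeration; by [eaddC] and [eaddA] the
   orthosum does not depend on the order of summation. *)
Definition orthosum (L : effectAlgebra) (a : nat -> L) (F : {fset nat}) :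
  option L := orthosum_seq [seq a n | n <- enum_fset F].

Definition orthogonal_seq (L : effectAlgebra) (a : nat -> L) : Prop :=
  forall F : {fset nat}, exists x, orthosum a F = Some x.

Definition is_inf_orthosum (L : effectAlgebra) (a : nat -> L) (s : L) : Prop :=
  eis_sup [set x | exists F : {fset nat}, orthosum a F = Some x] s.

Definition is_emeasure (R : realType) (L : effectAlgebra) (mu : L -> R) :
  Prop := forall a b c, eadd a b = Some c -> mu c = mu a + mu b.

Definition bounded_emeasure (R : realType) (L : effectAlgebra) (mu : L -> R) :
  Prop := is_emeasure mu /\ (ereal_sup [set `|mu a|%:E | a in setT] < +oo)%E.

Definition esigma_additive (R : realType) (L : effectAlgebra) (mu : L -> R) :
  Prop := forall (a : nat -> L) (s : L),
    orthogonal_seq a -> is_inf_orthosum a s ->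
    series (fun n => mu (a n)) @ \oo --> mu s.

Definition bounded_sigma_emeasure (R : realType) (L : effectAlgebra)
  (mu : L -> R) : Prop := bounded_emeasure mu /\ esigma_additive mu.

Definition pointwise_bounded (R : realType) (L : effectAlgebra)
    (mu : nat -> L -> R) : Prop :=
  forall a, (ereal_sup [set `|mu i a|%:E | i in setT] < +oo)%E.

Definition uniformly_bounded (R : realType) (L : effectAlgebra)
    (mu : nat -> L -> R) : Prop :=
  (ereal_sup [set ereal_sup [set `|mu i a|%:E | a in setT] | i in setT]
    < +oo)%E.

Definition pointwise_convergent (R : realType) (L : effectAlgebra)
    (mu : nat -> L -> R) : Prop :=
  forall a, cvg (mu i a @[i --> \oo]).

Definition uniformly_exhaustive (R : realType) (L : effectAlgebra)
    (mu : nat -> L -> R) : Prop :=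
  forall a : nat -> L, orthogonal_seq a ->
    {uniform, (fun n i : nat => mu i (a n)) @ \oo --> (fun _ : nat => 0 : R)}.

Definition uniformly_strongly_additive (R : realType) (L : effectAlgebra)
    (mu : nat -> L -> R) : Prop :=
  forall a : nat -> L, orthogonal_seq a ->
    exists S : nat -> R,
      {uniform, (fun n i : nat => series (fun k => mu i (a k)) n) @ \oo --> S}.

Definition nikodym_for (R : realType) (L : effectAlgebra)
    (C : (L -> R) -> Prop) : Prop :=
  forall mu : nat -> L -> R, (forall i, C (mu i)) ->
    pointwise_bounded mu -> uniformly_bounded mu.

Definition vitali_hahn_saks_for (R : realType) (L : effectAlgebra)
    (C : (L -> R) -> Prop) : Prop :=
  forall mu : nat -> L -> R, (forall i, C (mu i)) ->
    pointwise_convergent mu -> uniformly_exhaustive mu.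

Definition grothendieck_for (R : realType) (L : effectAlgebra)
    (C : (L -> R) -> Prop) : Prop :=
  forall mu : nat -> L -> R, (forall i, C (mu i)) ->
    pointwise_convergent mu -> uniformly_bounded mu ->
    uniformly_strongly_additive mu.

Definition nikodym_property (R : realType) (L : effectAlgebra) : Prop :=
  nikodym_for (@bounded_emeasure R L).
Definition vitali_hahn_saks_property (R : realType) (L : effectAlgebra) :
  Prop := vitali_hahn_saks_for (@bounded_emeasure R L).
Definition grothendieck_property (R : realType) (L : effectAlgebra) : Prop :=
  grothendieck_for (@bounded_emeasure R L).

Definition sigma_nikodym_property (R : realType) (L : effectAlgebra) : Prop :=
  nikodym_for (@bounded_sigma_emeasure R L).
Definition sigma_vitali_hahn_saks_property (R : realType)
  (L : effectAlgebra) : Prop :=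
  vitali_hahn_saks_for (@bounded_sigma_emeasure R L).
Definition sigma_grothendieck_property (R : realType) (L : effectAlgebra) :
  Prop := grothendieck_for (@bounded_sigma_emeasure R L).

(* Main.v *)
Require Import Defs.
From mathcomp Require Import all_boot all_order all_algebra.
From mathcomp Require Import all_classical all_reals all_analysis.

(** Pointwise convergence gives pointwise boundedness, which the Nikodym
    property upgrades to uniform boundedness, so the Grothendieck property
    applies.  Uniform strong additivity in turn gives uniform exhaustivity,
    since [mu_i (a_n)] is the difference of two consecutive partial sums. *)

Set Implicit Arguments.
Unset Strict Implicit.
Unset Printing Implicit Defensive.

Import Order.TTheory GRing.Theory Num.Theory.
Import numFieldNormedType.Exports.

Local Open Scope classical_set_scope.
Local Open Scope ring_scope.

(** The sets of pairs at distance less than [eps] form a base of the entourages of [R], so testing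
    them suffices. Keeping [t] under the [near] quantifier is what expresses uniformity. *)
Lemma uniform_cvgP (R : realType) (T : choiceType) (f : nat -> T -> R)
    (g : T -> R) :
  {uniform, f @ \oo --> g} <->
  forall eps : R, 0 < eps ->
    \forall n \near \oo, forall t, `|g t - f n t| < eps.
Proof.
split=> [fg eps eps0|fg P /uniform_nbhs[E [entE EP]]].
  apply: (fg [set h | forall t, `|g t - h t| < eps]).
  apply/uniform_nbhs; exists [set xy | ball xy.1 eps xy.2].
  split=> [|h hE t]; last exact: hE.
  by rewrite -entourage_ballE; exists eps.
have [eps /= eps0 epsE] : exists2 eps : R, 0 < eps &
    [set xy | ball xy.1 eps xy.2] `<=` E.
  by move: entE; rewrite -entourage_ballE => -[eps eps0 epsE]; exists eps.
apply: (filterS _ (fg _ eps0)) => n fgn; apply: EP => t _.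
by apply: epsE; exact: fgn.
Qed.

Lemma pointwise_convergent_bounded (R : realType) (L : effectAlgebra)
    (mu : nat -> L -> R) :
  pointwise_convergent mu -> Defs.pointwise_bounded mu.
Proof.
move=> mu_cvg a; have [M [_ muM]] := cvg_seq_bounded (mu_cvg a).
(* [muM] only provides bounds strictly above [M], hence [M + 1]. *)
apply: (@le_lt_trans _ _ (M + 1)%:E); last exact: ltry.
apply: ge_ereal_sup => _ [i _ <-]; rewrite lee_fin.
by apply: muM; rewrite ?ltrDl.
Qed.

Lemma uniformly_strongly_additive_exhaustive (R : realType)
    (L : effectAlgebra) (mu : nat -> L -> R) :
  uniformly_strongly_additive mu -> uniformly_exhaustive mu.
Proof.
move=> mu_add a /mu_add[S /uniform_cvgP muS]; apply/uniform_cvgP => eps eps0.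
have [N _ SN] : \forall n \near \oo, forall i,
    `|S i - series (fun k => mu i (a k)) n| < eps / 2.
  by apply: muS; rewrite divr_gt0.
exists N => // n /= Nn i.
(* [series] at [n] sums the indices below [n], so the term at [n] is the partial sum at [n.+1] minus
   the one at [n]. Both lie within [eps / 2] of [S i], as [N <= n]. *)
rewrite sub0r normrN -(seriesSB (fun k => mu i (a k))).
rewrite (le_lt_trans (ler_distD (S i) _ _))// (splitr eps) ltrD//; last exact: SN.
rewrite distrC; apply: SN => /=; exact: leqW.
Qed.

(** Leaving the class [C] arbitrary lets one argument serve both bounded measures and bounded
    sigma-additive ones. *)
Lemma grothendieck_nikodym_vitali_hahn_saks (R : realType) (L : effectAlgebra)
    (C : (L -> R) -> Prop) :
  grothendieck_for C -> nikodym_for C -> vitali_hahn_saks_for C.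
Proof.
move=> groC nikC mu muC mu_cvg; apply: uniformly_strongly_additive_exhaustive.
by apply: groC => //; apply: nikC => //; exact: pointwise_convergent_bounded.
Qed.

Theorem theorem3p2 (R : realType) (L : effectAlgebra) :
  (grothendieck_property R L -> nikodym_property R L ->
     vitali_hahn_saks_property R L) /\
  (sigma_grothendieck_property R L -> sigma_nikodym_property R L ->
     sigma_vitali_hahn_saks_property R L).
Proof. by split; exact: grothendieck_nikodym_vitali_hahn_saks. Qed.
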